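(* Let $\mathcal{O}$ be a discrete valuation domain, let $G$ be a finitely generated amenable group with a finite generating subset $S\subseteq G$ and a sofic approximation $(X_n)_{n\in\mathbb{N}}$, and let $a\in\mathcal{O}[F(S)]$. Then for every ideal $I$ of $\mathcal{O}$ the limit $$\lim_{n\to\infty}\nu_{X_n}^a\big(\{I\}\big)$$ exists and is independent of the sofic approximation $(X_n)_{n\in\mathbb{N}}$ of $G$.
   Context: A discrete valuation domain is a principal ideal domain $\mathcal{O}$ with a unique non-zero maximal ideal $\mathfrak{m}$; let $\pi$ be a generator of $\mathfrak{m}$ and $K$ the field of fractions of $\mathcal{O}$. The ideals of $\mathcal{O}$ are $\mathcal{I}(\mathcal{O})=\{0,\mathcal{O},\mathfrak{m},\mathfrak{m}^2,\dotsc\}$. $F(S)$ is the free group on $S$ and $G=F(S)/N$ with $N\trianglelefteq F(S)$ the kernel of the canonical surjection. A sequence $(X_n)_{n\in\mathbb{N}}$ of finite (right) $F(S)$-sets is a sofic approximation of $G$ if for every $r\in\mathbb{N}$ one has $\lim_{n\to\infty}|P_r(X_n)|/|X_n|=1$, where $P_r(X_n)$ is the set of $x\in X_n$ such that for every $w\in B_r(1_{F(S)})$ (the ball of radius $r$ around the identity in the word metric of $F(S)$ with respect to $S$) one has $xw=x$ if and only if $w\in N$. Definition of $\nu_{X_n}^a$: right multiplication by $a$, $x\mapsto xa$, defines a linear map $\phi_{X_n}^a$ on $K[X_n]$ given in the basis $X_n$ by a matrix $A_n\in\mathrm{Mat}_{|X_n|}(\mathcal{O})$. Its Smith normal form is diagonal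 with diagonal entries $\pi^{k_1},\dotsc,\pi^{k_t},0,\dotsc,0$, where $0\le k_1\le\dotsb\le k_t$. Then $\nu_{X_n}^a=\frac{1}{|X_n|}\big(\sum_{i=1}^t\delta_{\mathfrak{m}^{k_i}}+\sum_{i=t+1}^{|X_n|}\delta_0\big)$, a probability measure on $\mathcal{I}(\mathcal{O})$, where $\mathfrak{m}^0=\mathcal{O}$ and $\delta_I$ is the Dirac measure at $I$. *)

(* Defs.v *)
From HB Require Import structures.
From mathcomp Require Import all_boot all_order all_algebra finmap.
From mathcomp Require Import all_classical all_reals all_analysis.

Set Implicit Arguments.
Unset Strict Implicit.
Unset Printing Implicit Defensive.

Import Order.TTheory GRing.Theory Num.Theory.
Import numFieldNormedType.Exports.

Local Open Scope classical_set_scope.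
Local Open Scope ring_scope.

(* A letter (t, false) stands for t, and (t, true) for t^-1. *)
Definition linv (T : Type) (l : T * bool) : T * bool := (l.1, ~~ l.2).

Lemma linvK (T : Type) : involutive (@linv T).
Proof. by case=> t b; rewrite /linv /= negbK. Qed.

Definition reduced (T : eqType) (w : seq (T * bool)) : bool :=
  sorted (fun l l' => l' != linv l) w.

Definition push (T : eqType) (l : T * bool) (w : seq (T * bool)) :=
  if w is l' :: w' then if l' == linv l then w' else l :: w else [:: l].

Section ReducedWords.
Variable T : eqType.
Implicit Types (l : T * bool) (u v w : seq (T * bool)).

Lemma reduced_push l w : reduced w -> reduced (push l w).
Proof.
case: w => [//|l' w] /= rw; case: ifPn => [_|nl]; first exact: path_sorted rw.
by rewrite /= nl.
Qed.

Lemma reduced_foldr_push u w : reduced w -> reduced (foldr (@push T) w u).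
Proof. by move=> rw; elim: u => //= l u; apply: reduced_push. Qed.

Lemma push_linv l w : reduced w -> push l (push (linv l) w) = w.
Proof.
case: w => [|l' w] /=; first by rewrite eqxx.
rewrite linvK; case: eqP => [->|_] rw; last by rewrite /= eqxx.
by case: w rw => [//|l2 w] /= /andP[/negPf-> _].
Qed.

Lemma foldr_push_push l v w : reduced w ->
  foldr (@push T) w (push l v) = push l (foldr (@push T) w v).
Proof.
move=> rw; case: v => [//|l' v] /=; case: eqP => [->|_] //=.
by rewrite push_linv // reduced_foldr_push.
Qed.

Lemma foldr_push_reduced w : reduced w -> foldr (@push T) [::] w = w.
Proof.
elim: w => [//|l w IH] /= rw; rewrite (IH (path_sorted rw)).
by case: w rw {IH} => [//|l' w] /= /andP[/negPf-> _].
Qed.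

Lemma reduced_rev_linv w : reduced w -> reduced (rev (map (@linv T) w)).
Proof.
rewrite /reduced rev_sorted sorted_map.
by apply: sub_sorted => l l' /=; rewrite linvK eq_sym.
Qed.

End ReducedWords.

(* The free group on T: reduced words in the letters t and t^-1, multiplied by
   concatenation followed by reduction. *)
Record freeGroup (T : choiceType) := FreeGroup {
  fword :> seq (T * bool);
  fword_reduced : reduced fword }.

HB.instance Definition _ (T : choiceType) := [isSub for @fword T].
HB.instance Definition _ (T : choiceType) := [Choice of freeGroup T by <:].

Section FreeGroup.
Variable T : choiceType.
Implicit Types u v w : freeGroup T.

Definition fg_one : freeGroup T := @FreeGroup T [::] isT.
Definition fg_mul u v : freeGroup T :=
  FreeGroup (reduced_foldr_push u (fword_reduced v)).
Definition fg_inv u : freeGroup T :=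
  FreeGroup (reduced_rev_linv (fword_reduced u)).

Lemma fg_mulA : associative fg_mul.
Proof.
move=> u v w; apply: val_inj => /=; elim: (fword u) => //= l s ->.
by rewrite foldr_push_push // fword_reduced.
Qed.

Lemma fg_mul1 : left_id fg_one fg_mul.
Proof. by move=> u; apply: val_inj. Qed.

Lemma fg_mulr1 : right_id fg_one fg_mul.
Proof. by move=> u; apply: val_inj; rewrite /= foldr_push_reduced ?fword_reduced. Qed.

Lemma fg_mulV : left_inverse fg_one fg_inv fg_mul.
Proof.
case=> u ru; apply: val_inj => /=; elim: u ru => [//|l u IH] ru.
rewrite /= rev_cons -cats1 foldr_cat /= linvK eqxx.
exact/IH/(path_sorted ru).
Qed.

Lemma fg_mulrV : right_inverse fg_one fg_inv fg_mul.
Proof.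
case=> u ru; apply: val_inj => /=.
have H (s t : seq (T * bool)) : reduced t ->
    foldr (@push T) (foldr (@push T) t (rev (map (@linv T) s))) s = t.
  elim: s t => [//|l s IH] t rt.
  by rewrite /= rev_cons -cats1 foldr_cat /= IH ?reduced_push // push_linv.
rewrite -[in LHS](foldr_push_reduced (reduced_rev_linv ru)); exact: H.
Qed.

HB.instance Definition _ := isGroup.Build (freeGroup T)
  fg_mulA fg_mul1 fg_mulr1 fg_mulV fg_mulrV.

Definition free_gen (t : T) : freeGroup T := @FreeGroup T [:: (t, false)] isT.

End FreeGroup.

Section Words.
Variables (G : groupType) (T : Type) (f : T -> G).

Definition letter_val (l : T * bool) : G := if l.2 then ((f l.1)^-1)%g else f l.1.

Definition word_val (u : seq (T * bool)) : G := (\prod_(l <- u) letter_val l)%g.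

(* Ball of radius r around 1 in the word metric of the family f. *)
Definition word_ball (r : nat) : set G :=
  [set g | exists2 u : seq (T * bool), (size u <= r)%N & word_val u = g].

Lemma letter_val_linv l : (letter_val l * letter_val (linv l))%g = 1%g.
Proof. by case: l => t []; rewrite /letter_val /= ?mulgV ?mulVg. Qed.

End Words.

Definition free_lift (G : groupType) (T : choiceType) (f : T -> G)
  (w : freeGroup T) : G := word_val f w.

Lemma free_lift_monoid_morphism (G : groupType) (T : choiceType) (f : T -> G) :
  monoid.monoid_morphism (free_lift f).
Proof.
split; first by rewrite /free_lift /word_val big_nil.
move=> u v; rewrite /free_lift /=; elim: (fword u) => /= [|l s IH].
  by rewrite [X in (X * _)%g]/word_val big_nil mul1g.
have P w : word_val f (push l w) = (letter_val f l * word_val f w)%g.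
  case: w => [|l' w] /=; first by rewrite /word_val big_seq1 big_nil mulg1.
  case: eqP => [->|_]; last by rewrite /word_val big_cons.
  by rewrite /word_val big_cons mulgA letter_val_linv mul1g.
by rewrite P IH mulgA /word_val big_cons.
Qed.

HB.instance Definition _ (G : groupType) (T : choiceType) (f : T -> G) :=
  isUMagmaMorphism.Build (freeGroup T) G (free_lift f)
    (free_lift_monoid_morphism f).

(* Amenability is taken in the form of Foelner's condition. *)
Definition amenable (G : groupType) : Prop :=
  forall (E : {fset G}) (e : rat), 0 < e ->
  exists2 F : {fset G}, F != fset0 &
    (#|` ([fset (x * g)%g | x in F, g in E] `\` F)%fset|)%:R
      <= e * (#|` F|)%:R.

Section Sofic.
Variables (G : groupType) (S : {fset G}).

Definition free_to_group : freeGroup S -> G := free_lift (fun s : S => val s).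

Definition generates : Prop := forall g : G, exists w, free_to_group w = g.

End Sofic.

Record finRightSet (F : groupType) := FinRightSet {
  frs_sort :> finType;
  ract : frs_sort -> F -> frs_sort;
  ract1 : forall x, ract x 1%g = x;
  ractM : forall x u v, ract x (u * v)%g = ract (ract x u) v }.

(* The set P_r(X). *)
Definition good_points (G : groupType) (S : {fset G})
    (X : finRightSet (freeGroup S)) (r : nat) : {set X} :=
  [set x : X | `[< forall w, word_ball (@free_gen S) r w ->
                   (ract x w = x <-> free_to_group w = 1%g) >]]%SET.

(* Since x / 0 = 0, the limit forces X n to be non-empty for n large. *)
Definition sofic_approximation (R : realType) (G : groupType) (S : {fset G})
    (X : nat -> finRightSet (freeGroup S)) : Prop :=
  forall r : nat,
    #|good_points (X n) r|%:R / #|X n|%:R @[n --> \oo] --> (1 : R).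

Definition is_ideal (O : comNzRingType) (I : set O) : Prop :=
  [/\ I 0, (forall x y, I x -> I y -> I (x + y))
    & forall c x, I x -> I (c * x)].

Record ideal (O : comNzRingType) := Ideal {
  ideal_set :> set O;
  ideal_setP : is_ideal ideal_set }.

Lemma ideal_ext (O : comNzRingType) (I J : ideal O) :
  ideal_set I = ideal_set J -> I = J.
Proof.
case: I J => [I hI] [J hJ] /= E; move: hI hJ; rewrite E => hI hJ.
by rewrite (Prop_irrelevance hI hJ).
Qed.

Section Ideals.
Variable O : comNzRingType.
Implicit Types I J : ideal O.

Lemma unit_ideal_subproof : is_ideal [set: O]. Proof. by []. Qed.
Definition unit_ideal : ideal O := Ideal unit_ideal_subproof.

Lemma principal_subproof (x : O) : is_ideal [set y | exists c, y = c * x].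
Proof.
split=> /=; first by exists 0; rewrite mul0r.
- by move=> _ _ [c ->] [d ->]; exists (c + d); rewrite mulrDl.
- by move=> c _ [d ->]; exists (c * d); rewrite mulrA.
Qed.
Definition principal (x : O) : ideal O := Ideal (principal_subproof x).

Definition zero_ideal : ideal O := principal 0.

Lemma ideal_mul_subproof I J : is_ideal
  [set z | exists2 s : seq (O * O), (forall p, p \in s -> ideal_set I p.1 /\ ideal_set J p.2)
           & z = \sum_(p <- s) p.1 * p.2].
Proof.
split=> /=; first by exists [::]; rewrite ?big_nil.
- move=> _ _ [s hs ->] [t ht ->]; exists (s ++ t); last by rewrite big_cat.
  by move=> p; rewrite mem_cat => /orP[/hs|/ht].
- move=> c _ [s hs ->]; exists [seq (c * p.1, p.2) | p <- s].
    move=> _ /mapP[p /hs[Ip Jp] ->] /=; split=> //.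
    by case: (ideal_setP I) => _ _; apply.
  by rewrite big_map mulr_sumr; apply: eq_bigr => p _; rewrite mulrA.
Qed.
Definition ideal_mul I J : ideal O := Ideal (ideal_mul_subproof I J).

Definition ideal_exp I (k : nat) : ideal O := iter k (ideal_mul I) unit_ideal.

Definition maximal_ideal I : Prop :=
  I <> unit_ideal /\
  forall J, ideal_set I `<=` ideal_set J -> J = I \/ J = unit_ideal.

End Ideals.

Definition discrete_valuation_domain (O : idomainType) (m : ideal O) : Prop :=
  (forall I : ideal O, exists x, I = principal x) /\
  unique (fun M : ideal O => maximal_ideal M /\ M <> zero_ideal O) m.

HB.instance Definition _ (O : comNzRingType) := gen_eqMixin (ideal O).
HB.instance Definition _ (O : comNzRingType) := gen_choiceMixin (ideal O).
HB.instance Definition _ (O : comNzRingType) :=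
  isPointed.Build (ideal O) (zero_ideal O).
HB.instance Definition _ (O : comNzRingType) :=
  @isMeasurable.Build default_measure_display (ideal O)
    (@discrete_measurable (ideal O)) (@discrete_measurable0 (ideal O))
    (@discrete_measurableC (ideal O)) (@discrete_measurableU (ideal O)).

Definition smith_mx (O : comNzRingType) (pi : O) (n : nat) (ks : seq nat) :
    'M[O]_n :=
  \matrix_(i, j) (if (i == j) && (i < size ks)%N then pi ^+ nth 0%N ks i else 0).

Definition is_smith_normal_form (O : idomainType) (pi : O) (n : nat)
    (A : 'M[O]_n) (ks : seq nat) : Prop :=
  [/\ sorted leq ks, (size ks <= n)%N
    & exists P Q : 'M[O]_n,
        [/\ P \in unitmx, Q \in unitmx & P *m A *m Q = smith_mx pi n ks]].

(* The exponents k_1 <= ... <= k_t.  Over a discrete valuation domain with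
   uniformizer pi they exist and are unique, so neither the default value nor
   the choice matters. *)
Definition smith_exponents (O : idomainType) (pi : O) (n : nat)
    (A : 'M[O]_n) : seq nat :=
  xget [::] [set ks | is_smith_normal_form pi A ks].

(* The matrix of right multiplication by a on K[X], K the fraction field of O,
   where X is ordered by enum_val: row i lists the coordinates of
   x_i a = \sum_w a_w (x_i w) in the basis X, which lie in O.
   An element of the group ring O[F] is a finitely supported function on F. *)
Definition rmul_mx (O : idomainType) (F : groupType) (X : finRightSet F)
    (a : {fsfun F -> O with 0}) : 'M[O]_#|X| :=
  \matrix_(i, j)
    \sum_(w <- finsupp a | ract (enum_val i) w == enum_val j) a w.

Section Nu.
Variables (R : realType) (O : idomainType) (m : ideal O) (pi : O).
Variables (F : groupType) (X : finRightSet F) (a : {fsfun F -> O with 0}).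

(* The ideal generated by the i-th diagonal entry, i counted from 0. *)
Definition smith_ideal (i : nat) : ideal O :=
  let ks := smith_exponents pi (rmul_mx X a) in
  if (i < size ks)%N then ideal_exp m (nth 0%N ks i) else zero_ideal O.

Definition nu : {measure set (ideal O) -> \bar R} :=
  mscale (#|X|%:R^-1)%:nng
    (msum (fun i => dirac (smith_ideal i)) #|X|).

End Nu.

(* Main.v *)
Require Import Defs.
From HB Require Import structures.
From mathcomp Require Import all_boot all_order all_algebra finmap.
From mathcomp Require Import all_classical all_reals all_analysis.
From mathcomp Require Import ring lra zify fraction generic_quotient ring_quotient.

Set Implicit Arguments.
Unset Strict Implicit.
Unset Printing Implicit Defensive.

Import Order.TTheory GRing.Theory Num.Theory.
Import numFieldNormedType.Exports.

Local Open Scope classical_set_scope.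
Local Open Scope ring_scope.

(** Write A_n for the matrix of right multiplication by a on K[X_n] and
    k_1 <= ... <= k_t for its Smith exponents.  The mass of nu at m^j is the
    proportion of the exponents equal to j, and this proportion is a second
    difference in k of sum_i max(k - k_i, 0) / |X_n|, where the sum is the length
    of the image of A_n over O/pi^k; the mass at 0 is 1 - t / |X_n|, where t is
    the rank of A_n over the field of fractions.  It is therefore enough to prove,
    for a commutative ring A of finite length kappa under O, that
    len (image of A_n over A) / |X_n| has a limit that does not depend on the
    sofic approximation (rowspace_density_limit).

    The engine is the inequality sum_len_supported: if U is a submodule of A^X and
    a family of subsets T_x of X covers each point at most s times, then
    sum_x len (U meet A^(T_x)) <= s * len U.  Indeed len U is the sum over the
    points of X of the lengths of the ideals of leading coefficients of U at that
    point (len_lead), and passing to U meet A^T shrinks these ideals and kills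
    those outside T.

    Let E be a finite subset of G, let q(E) |E| be the length of the module of
    elements of A[G] supported on E and annihilated by right multiplication by a
    (relations), and translate E and E supp(a) by the points x of X_n.  For all but
    a vanishing proportion of the points, the neighbourhood of x looks like that
    of 1 in G.  Then the inequality gives
    - for U the kernel and T_x = x E:  len (kernel) / |X_n| >= q(E) asymptotically;
    - for U the image and T_x = x E supp(a):
      len (image) / |X_n| >= (kappa - q(E)) |E| / |E supp(a)| asymptotically,
      because x E supp(a) supports the image of A^(x E), of length
      (kappa - q(E)) |E|.
    Amenability makes |E| / |E supp(a)| as close to 1 as wanted, and the two
    lengths add up to kappa |X_n|.  Hence len (image) / |X_n| is squeezed to
    kappa - sup_E q(E), a number defined by G, S and a alone. *)

(** * Length of modules *)

Section ModuleLength.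
Variable A : nzRingType.

Definition submodule (V : lmodType A) (U : set V) : Prop :=
  U 0 /\ forall c x y, U x -> U y -> U (c *: x + y).

Fixpoint has_chain (V : lmodType A) (t : nat) (U : set V) : Prop :=
  if t is s.+1
  then exists2 U' : set V, submodule U' /\ U' `<` U & has_chain s U'
  else True.

Definition finite_length (V : lmodType A) (U : set V) : Prop :=
  exists t, ~ has_chain t U.

(** The largest length of a strictly increasing chain of submodules ending at U;
    the default value 0 is reached only when such chains are unbounded. *)
Definition len (V : lmodType A) (U : set V) : nat :=
  xget 0%N [set t | has_chain t U /\ ~ has_chain t.+1 U].

Lemma has_chainS (V : lmodType A) t (U U' : set V) :
  U `<=` U' -> has_chain t U -> has_chain t U'.
Proof.
case: t => //= t sUU' [W [sW [WU nUW]] cW]; exists W => //; split=> //; split.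
  exact: subset_trans sUU'.
by move=> U'W; apply: nUW; apply: subset_trans U'W.
Qed.

Lemma has_chainW (V : lmodType A) s t (U : set V) :
  (s <= t)%N -> has_chain t U -> has_chain s U.
Proof.
elim: s t U => // s IH [//|t] U st /= [W hW cW]; exists W => //; exact: IH cW.
Qed.

Lemma lenP (V : lmodType A) t (U : set V) :
  finite_length U -> has_chain t U <-> (t <= len U)%N.
Proof.
move=> [b nb]; rewrite /len.
have [s [hs nhs]] : exists s, has_chain s U /\ ~ has_chain s.+1 U.
  elim: b nb => [/(_ I)//|b IH] nb.
  by have [?|/IH//] := EM (has_chain b U); exists b.
case: xgetP => [_ -> [c nc]|/(_ s)]; last by case.
split=> [ht|ht]; last exact: has_chainW c.
by rewrite leqNgt; apply/negP => lt; apply: nc; apply: has_chainW ht.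
Qed.

Lemma finite_lengthS (V : lmodType A) (U U' : set V) :
  U `<=` U' -> finite_length U' -> finite_length U.
Proof. by move=> sU [t nt]; exists t => /(has_chainS sU). Qed.

Lemma len_mono (V : lmodType A) (U U' : set V) :
  finite_length U' -> U `<=` U' -> (len U <= len U')%N.
Proof.
move=> f' sU; apply/lenP => //; apply: (has_chainS sU).
by apply/lenP => //; apply: finite_lengthS f'.
Qed.

Lemma len_eq (V : lmodType A) t (U : set V) :
  has_chain t U -> ~ has_chain t.+1 U -> len U = t.
Proof.
move=> ht nt; have fU : finite_length U by exists t.+1.
apply/eqP; rewrite eqn_leq; apply/andP; split; last exact/(lenP _ fU).
by rewrite leqNgt; apply/negP => /(lenP _ fU).
Qed.

Lemma finite_length0 (V : lmodType A) : finite_length [set 0 : V].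
Proof. by exists 1%N => /= -[W [[W0 _] [_]]]; case=> _ ->. Qed.

Lemma len0 (V : lmodType A) : len [set 0 : V] = 0%N.
Proof.
by apply: len_eq => // -[W [[W0 _] [_]]]; case=> _ ->.
Qed.

Section Additivity.
Variables (V W : lmodType A) (f : V -> W).
Hypothesis f_lin : forall c x y, f (c *: x + y) = c *: f x + f y.

Local Notation ker := (f @^-1` [set 0]).

Let f0 : f 0 = 0.
Proof. by have := f_lin (-1) 0 0; rewrite !scaleN1r !addNr. Qed.

Lemma submodule_image (U : set V) : submodule U -> submodule (f @` U).
Proof.
move=> [U0 UD]; split; first by exists 0.
by move=> c _ _ [x Ux <-] [y Uy <-]; exists (c *: x + y); [exact: UD|].
Qed.

Lemma submodule_preimage (U : set W) : submodule U -> submodule (f @^-1` U).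
Proof.
move=> [U0 UD]; split; first by rewrite /= f0.
by move=> c x y /= Ux Uy; rewrite f_lin; apply: UD.
Qed.

Lemma submoduleI (U U' : set V) :
  submodule U -> submodule U' -> submodule (U `&` U').
Proof.
move=> [U0 UD] [U0' UD']; split=> // c x y [? ?] [? ?].
by split; [apply: UD|apply: UD'].
Qed.

Lemma submodule_ker : submodule ker.
Proof.
by apply: submodule_preimage; split=> //= c _ _ -> ->; rewrite scaler0 addr0.
Qed.

(** At each strict step of a chain, the intersection with the kernel or the image
    must grow: if neither did, the modular law would give equality. *)
Lemma has_chain_split t (U : set V) : submodule U -> has_chain t U ->
  exists t1 t2, [/\ t = (t1 + t2)%N, has_chain t1 (U `&` ker)
                  & has_chain t2 (f @` U)].
Proof.
elim: t U => [|t IH] U sU; first by exists 0%N, 0%N.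
move=> [U' [sU' [U'U nUU']] /(IH _ sU')[t1 [t2 [-> c1 c2]]]].
have [fUU'|nf] := EM (f @` U `<=` f @` U'); last first.
  exists t1, t2.+1; split; first by rewrite addnS.
    by apply: has_chainS c1 => x [/U'U].
  exists (f @` U') => //; split; first exact: submodule_image.
  by split=> // _ [x /U'U Ux <-]; exists x.
exists t1.+1, t2; split; [by rewrite addSn| |]; last first.
  by apply: has_chainS c2 => _ [x /U'U Ux <-]; exists x.
exists (U' `&` ker) => //; split.
  by apply: submoduleI => //; apply: submodule_ker.
split; first by move=> x [/U'U].
move=> kk; apply: nUU' => x Ux.
have [x' U'x' fx'] : (f @` U') (f x) by apply: fUU'; exists x.
have [UD U'D] := (sU.2, sU'.2).
(* An element x of U outside U' differs from some x' in U' by an element of the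
   kernel, which cannot lie in U'. *)
have : (U `&` ker) (-1 *: x' + x).
  split; first by apply: UD => //; apply: U'U.
  by rewrite /= f_lin fx' scaleN1r addNr.
move=> /kk[U'd _]; have := U'D 1 _ _ U'd U'x'.
by rewrite scale1r scaleN1r addrAC addNr add0r.
Qed.

(** A chain of the image pulls back to a chain above the kernel part. *)
Lemma has_chain_join t1 t2 (U : set V) : submodule U ->
  has_chain t1 (U `&` ker) -> has_chain t2 (f @` U) -> has_chain (t1 + t2) U.
Proof.
elim: t2 U => [|t2 IH] U sU c1 c2.
  by rewrite addn0; apply: has_chainS c1 => x [].
case: c2 => W' [sW' [W'U nUW']] c2; rewrite addnS.
exists (U `&` f @^-1` W'); first split.
- by apply: submoduleI => //; apply: submodule_preimage.
- split; first by move=> x [].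
  by move=> UU; apply: nUW' => _ [x /UU[_ Wx] <-].
apply: IH; first by apply: submoduleI => //; apply: submodule_preimage.
  apply: has_chainS c1 => x [Ux kx]; split=> //; split=> //=.
  by rewrite kx; case: sW'.
by apply: has_chainS c2 => y W'y; have [x Ux fx] := W'U _ W'y; exists x => //;
  split=> //=; rewrite fx.
Qed.

(** Rank-nullity for lengths; additivity in exact sequences and invariance under
    isomorphism are instances. *)
Lemma len_ker_image (U : set V) : submodule U ->
  finite_length (U `&` ker) -> finite_length (f @` U) ->
  finite_length U /\ len U = (len (U `&` ker) + len (f @` U))%N.
Proof.
move=> sU f1 f2.
have ub t : has_chain t U -> (t <= len (U `&` ker) + len (f @` U))%N.
  move=> /(has_chain_split sU)[t1 [t2 [-> c1 c2]]].
  by apply: leq_add; apply/lenP.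
have fU : finite_length U.
  by exists (len (U `&` ker) + len (f @` U)).+1 => /ub; rewrite ltnn.
split=> //; apply/eqP; rewrite eqn_leq ub /=; last exact/lenP.
by apply/lenP => //; apply: has_chain_join => //; apply/lenP.
Qed.

Lemma len_inj (U : set V) : submodule U -> finite_length (f @` U) ->
  (forall x, U x -> f x = 0 -> x = 0) -> len (f @` U) = len U.
Proof.
move=> sU fU inj.
have E : U `&` ker = [set 0].
  apply/seteqP; split=> x /=; first by case=> Ux /(inj _ Ux).
  by move=> ->; split=> //; case: sU.
have [] := len_ker_image sU _ fU; rewrite E; first exact: finite_length0.
by rewrite len0 add0n.
Qed.

End Additivity.

End ModuleLength.

(** * Submodules of a free module and their leading coefficients *)

Section Coordinates.
Variable A : nzRingType.
Hypothesis finA : finite_length [set: A^o].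

Definition below n (k : nat) : set 'rV[A]_n :=
  [set u | forall j : 'I_n, (k <= j)%N -> u 0 j = 0].

Definition supported n (T : {set 'I_n}) : set 'rV[A]_n :=
  [set u | forall j, j \notin T -> u 0 j = 0].

(** The ideal of leading coefficients at i, the leading position of a vector being
    the last one at which it does not vanish. *)
Definition lead n (U : set 'rV[A]_n) (i : 'I_n) : set A^o :=
  (fun u : 'rV[A]_n => u 0 i : A^o) @` (U `&` @below n i.+1).

Lemma coord_linear n (i : 'I_n) c (x y : 'rV[A]_n) :
  (c *: x + y) 0 i = c *: (x 0 i : A^o) + (y 0 i : A^o).
Proof. by rewrite !mxE. Qed.

Lemma submodule_below n k : submodule (@below n k).
Proof.
split=> [j _|c x y bx By j kj]; first by rewrite mxE.
by rewrite !mxE bx ?By // mulr0 addr0.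
Qed.

Lemma submodule_supported n (T : {set 'I_n}) : submodule (supported T).
Proof.
split=> [j _|c x y bx By j kj]; first by rewrite mxE.
by rewrite !mxE bx ?By // mulr0 addr0.
Qed.

Lemma gtn_ord_neq n (i j : 'I_n) : (i < j)%N -> j != i.
Proof. by move=> ij; rewrite -val_eqE /= (gtn_eqF ij). Qed.

(** The i-th coordinate maps the vectors of U vanishing after i onto the ideal of
    leading coefficients at i, and its kernel there consists of the vectors
    vanishing from i on. *)
Lemma len_below n (U : set 'rV[A]_n) k : submodule U -> (k <= n)%N ->
  finite_length (U `&` @below n k) /\
  len (U `&` @below n k) = (\sum_(i < n | (i < k)%N) len (lead U i))%N.
Proof.
move=> sU; elim: k => [_|k IH kn].
  have -> : U `&` @below n 0 = [set 0].
    apply/seteqP; split=> [x [_ bx]|x ->] /=.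
      by apply/rowP => j; rewrite bx // mxE.
    by split; [case: sU|case: (submodule_below n 0)].
  by rewrite len0 big1 //; split=> //; apply: finite_length0.
have [fk lk] := IH (ltnW kn); pose i := Ordinal kn.
have sB := submoduleI sU (submodule_below n k.+1).
have E : (U `&` @below n k.+1) `&` (fun u : 'rV[A]_n => u 0 i : A^o) @^-1` [set 0]
       = U `&` @below n k.
  apply/seteqP; split=> x /=.
    move=> [[Ux bx] x0]; split=> // j; rewrite leq_eqVlt => /orP[/eqP kj|/bx//].
    by have -> : j = i by apply: val_inj.
  move=> [Ux bx]; split; last by rewrite bx.
  by split=> // j kj; rewrite bx // ltnW.
have [] := len_ker_image (f := fun u : 'rV[A]_n => u 0 i : A^o)
  (@coord_linear n i) sB; rewrite ?E //.
  exact: finite_lengthS finA.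
move=> fk1 ->; split=> //; rewrite lk [RHS](bigD1 i) //= addnC; congr (_ + _)%N.
apply: eq_bigl => j; rewrite ltnS [in RHS]leq_eqVlt -val_eqE /=.
by case: ltngtP.
Qed.

Lemma len_lead n (U : set 'rV[A]_n) : submodule U ->
  len U = (\sum_(i < n) len (lead U i))%N.
Proof.
move=> sU; have [_] := len_below sU (leqnn n).
have -> : U `&` @below n n = U.
  by apply/seteqP; split=> [x []//|x Ux]; split=> // j; rewrite leqNgt ltn_ord.
by move=> ->; apply: eq_bigl => i; rewrite ltn_ord.
Qed.

Lemma finite_length_rV n (U : set 'rV[A]_n) : finite_length U.
Proof.
apply: (@finite_lengthS _ _ _ setT) => //.
have sT : submodule [set: 'rV[A]_n] by [].
have [+ _] := len_below sT (leqnn n); rewrite setTI; congr finite_length.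
by apply/seteqP; split=> // x _ j; rewrite leqNgt ltn_ord.
Qed.

Lemma len_rVT n : len [set: 'rV[A]_n] = (n * len [set: A^o])%N.
Proof.
rewrite len_lead // (eq_bigr (fun=> len [set: A^o])) => [|i _].
  by rewrite sum_nat_const card_ord.
congr len; apply/seteqP; split=> // c _.
exists (c *: delta_mx 0 i); last by rewrite !mxE !eqxx mulr1.
by split=> // j ij; rewrite !mxE (negPf (gtn_ord_neq ij)) andbF mulr0.
Qed.

(** Restricting U to the vectors supported on T shrinks each ideal of leading
    coefficients and annihilates those at the positions outside T, so the ideal at
    i is counted at most s times on the left. *)
Lemma sum_len_supported n (U : set 'rV[A]_n) (I : finType)
    (T : I -> {set 'I_n}) s : submodule U ->
  (forall j, (#|[set x | j \in T x]%SET| <= s)%N) ->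
  (\sum_x len (U `&` supported (T x)) <= s * len U)%N.
Proof.
move=> sU hT.
have sUT x := submoduleI sU (submodule_supported (T x)).
have leadT x i :
    (len (lead (U `&` supported (T x)) i) <= (i \in T x) * len (lead U i))%N.
  case: (boolP (i \in T x)) => [_|nT]; rewrite ?[leqRHS]mul1n ?[leqRHS]mul0n.
    apply: len_mono; first exact: finite_lengthS finA.
    by move=> _ [u [[Uu _] bu] <-]; exists u.
  rewrite -[leqRHS](len0 A^o); apply: len_mono; first exact: finite_length0.
  by move=> _ [u [[Uu su] bu] <-] /=; rewrite su.
apply: (@leq_trans (\sum_x \sum_i (i \in T x) * len (lead U i))%N).
  by apply: leq_sum => x _; rewrite len_lead //; apply: leq_sum.
rewrite exchange_big /= [in leqRHS](len_lead sU) big_distrr /=.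
apply: leq_sum => i _; rewrite -big_distrl /=; apply: leq_mul => //.
by have := hT i; rewrite -sum1dep_card big_mkcond.
Qed.

Definition rowspace m n (M : 'M[A]_(m, n)) : set 'rV[A]_n :=
  range (fun u : 'rV[A]_m => u *m M).

Definition lker m n (M : 'M[A]_(m, n)) : set 'rV[A]_m :=
  [set u | u *m M = 0].

Lemma mulmx_linear m n (M : 'M[A]_(m, n)) c (x y : 'rV[A]_m) :
  (c *: x + y) *m M = c *: (x *m M) + y *m M.
Proof. by rewrite mulmxDl scalemxAl. Qed.

Lemma submodule_rowspace m n (M : 'M[A]_(m, n)) : submodule (rowspace M).
Proof. exact: (submodule_image (mulmx_linear M)). Qed.

Lemma submodule_lker m n (M : 'M[A]_(m, n)) : submodule (lker M).
Proof. exact: (submodule_ker (mulmx_linear M)). Qed.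

Lemma len_lker_rowspace m n (M : 'M[A]_(m, n)) :
  (len (lker M) + len (rowspace M) = m * len [set: A^o])%N.
Proof.
have sT : submodule [set: 'rV[A]_m] by [].
have [] := len_ker_image (mulmx_linear M) sT; try exact: finite_length_rV.
by rewrite setTI len_rVT => _ ->.
Qed.

Lemma len_rowspace_equiv n (P P' M Q Q' : 'M[A]_n) :
  P' *m P = 1%:M -> Q *m Q' = 1%:M ->
  len (rowspace (P *m M *m Q)) = len (rowspace M).
Proof.
move=> P'P QQ'.
have -> : rowspace (P *m M *m Q) = (fun u : 'rV[A]_n => u *m Q) @` rowspace M.
  apply/seteqP; split=> [_ [u _ <-]|_ [_ [u _ <-] <-]].
    by exists (u *m P *m M); [exists (u *m P)|rewrite !mulmxA].
  by exists (u *m P') => //; rewrite !mulmxA -(mulmxA u) P'P mulmx1.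
apply: (len_inj (mulmx_linear Q)); first exact: submodule_rowspace.
  exact: finite_length_rV.
by move=> x _ xQ; rewrite -[x]mulmx1 -QQ' mulmxA xQ mul0mx.
Qed.

Lemma len_rowspace_diag n (d : 'I_n -> A) :
  len (rowspace (\matrix_(i, j) (if i == j then d i else 0)))
  = (\sum_i len (range (fun c : A => c * d i : A^o)%R))%N.
Proof.
have E (u : 'rV[A]_n) i :
    (u *m \matrix_(i, j) (if i == j then d i else 0)) 0 i = u 0 i * d i.
  rewrite mxE (bigD1 i) //= mxE eqxx big1 ?addr0 // => j ij.
  by rewrite mxE (negPf ij) mulr0.
rewrite len_lead; last exact: submodule_rowspace.
apply: eq_bigr => i _; congr len; apply/seteqP; split=> [_ [_ [[u _ <-] _] <-]|].
  by exists (u 0 i) => //; rewrite E.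
move=> _ [c _ <-]; exists (c *: delta_mx 0 i *m
  \matrix_(i, j) (if i == j then d i else 0)); last by rewrite E !mxE !eqxx mulr1.
split; first by exists (c *: delta_mx 0 i).
by move=> j ij; rewrite E !mxE (negPf (gtn_ord_neq ij)) andbF mulr0 mul0r.
Qed.

End Coordinates.

(** * Sofic approximations look locally like the group *)

Section LocalModel.
Variables (G : groupType) (S : {fset G}).

Local Notation pr := (@free_to_group G S).

Lemma free_to_groupM (u v : freeGroup S) : pr (u * v)%g = (pr u * pr v)%g.
Proof. exact: (free_lift_monoid_morphism (fun s : S => val s)).2. Qed.

Lemma free_to_group1 : pr 1%g = 1%g.
Proof. exact: (free_lift_monoid_morphism (fun s : S => val s)).1. Qed.

Lemma free_to_group_eq (u v : freeGroup S) : (pr (u * v^-1)%g = 1%g) <-> (pr u = pr v).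
Proof.
have pv : (pr (v^-1)%g * pr v = 1)%g by rewrite -free_to_groupM mulVg free_to_group1.
split=> [E|E]; last by rewrite free_to_groupM E -free_to_groupM mulgV free_to_group1.
by have := mulgVK v u => {1}<-; rewrite free_to_groupM E mul1g.
Qed.

Lemma word_ball_size (T : choiceType) (w : freeGroup T) :
  word_ball (@free_gen T) (size w) w.
Proof.
exists (fword w) => //; apply: val_inj; rewrite /=.
rewrite -[RHS](foldr_push_reduced (fword_reduced w)).
elim: (fword w) => [|l s IH]; first by rewrite /word_val big_nil.
rewrite /word_val big_cons -/(word_val _ _) /= -IH.
by case: l => t [].
Qed.

Lemma word_ballW (T : choiceType) r s (w : freeGroup T) : (r <= s)%N ->
  word_ball (@free_gen T) r w -> word_ball (@free_gen T) s w.
Proof. by move=> rs [u ur uw]; exists u => //; apply: leq_trans rs. Qed.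

(** The words of W act on x with the same coincidences as their images act on the
    unit of G. *)
Definition separates (X : finRightSet (freeGroup S)) (x : X)
    (W : seq (freeGroup S)) : Prop :=
  {in W &, forall u v, (ract x u == ract x v) = (pr u == pr v)}.

(** x u = x v means that u v^-1 fixes x, so the radius only has to bound the
    lengths of the finitely many words u v^-1. *)
Lemma good_points_separate (W : seq (freeGroup S)) :
  exists r, forall (X : finRightSet (freeGroup S)) (x : X),
    x \in good_points X r -> separates x W.
Proof.
pose r := (\max_(u <- W) \max_(v <- W) size (u * v^-1)%g)%N.
exists r => X x; rewrite inE => /asboolP gx u v uW vW.
have := gx (u * v^-1)%g; case.
  apply: word_ballW (word_ball_size _).
  apply: leq_trans (leq_bigmax_seq (F := fun u => \max_(v <- W) size (u * v^-1)%g)%N _ uW _) => //.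
  exact: (leq_bigmax_seq (F := fun v => size (u * v^-1)%g)).
move=> h1 h2; apply/eqP/eqP.
  by move=> E; apply/free_to_group_eq/h1; rewrite ractM E -ractM mulgV ract1.
move=> /free_to_group_eq/h2 E.
by rewrite -{2}E -ractM mulgVK.
Qed.

Section Convolution.
Variables (A : nzRingType) (ws : seq (freeGroup S)) (b : freeGroup S -> A).
Hypothesis finA : finite_length [set: A^o].

Definition conv_mx (X : finRightSet (freeGroup S)) : 'M[A]_#|X| :=
  \matrix_(i, j) \sum_(w <- ws | ract (enum_val i) w == enum_val j) b w.

(** The elements of A[G] supported on the images of the words es and annihilated
    by right multiplication by the sum of the b w * w, as vectors of coefficients.
    Keeping coefficients indexed by es puts these vectors in a free module of
    finite rank, whatever G is. *)
Definition relations (es : seq (freeGroup S)) : set 'rV[A]_(size es) :=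
  [set c | forall h : G, \sum_(k < size es)
     \sum_(w <- ws | pr (nth 1%g es k * w)%g == h) c 0 k * b w = 0].
Arguments relations es : clear implicits.

Definition translate (X : finRightSet (freeGroup S)) (x : X)
    (es : seq (freeGroup S)) : {set 'I_#|X|} :=
  [set j : 'I_#|X| | has (fun e => ract x e == enum_val j) es]%SET.

(** The matrix of the map that moves coefficients on es to the points x e of X. *)
Definition place_mx (X : finRightSet (freeGroup S)) (x : X)
    (es : seq (freeGroup S)) : 'M[A]_(size es, #|X|) :=
  \matrix_(k, j) (ract x (nth 1%g es k) == enum_val j)%:R.

(** If j = x e then x = j e^-1. *)
Lemma card_translate (X : finRightSet (freeGroup S))
    (es : seq (freeGroup S)) (j : 'I_#|X|) :
  (#|[set x : X | j \in translate x es]%SET| <= size es)%N.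
Proof.
rewrite -(size_map (fun e => ract (enum_val j) (e^-1)%g)).
apply: leq_trans (card_size _); apply/subset_leq_card/fintype.subsetP => x.
rewrite !inE => /hasP[e ees /eqP xe]; apply/mapP; exists e => //.
by rewrite -xe -ractM mulgV ract1.
Qed.

Lemma place_mx_conv (X : finRightSet (freeGroup S)) (x : X)
    (es : seq (freeGroup S))
    (c : 'rV[A]_(size es)) j :
  (c *m (place_mx x es *m conv_mx X)) 0 j = \sum_(k < size es)
    \sum_(w <- ws | ract x (nth 1%g es k * w)%g == enum_val j) c 0 k * b w.
Proof.
rewrite mxE; apply: eq_bigr => k _; rewrite mxE.
rewrite (bigD1 (enum_rank (ract x (nth 1%g es k)))) //= big1 ?addr0 => [|i ik].
  rewrite !mxE enum_rankK eqxx mul1r mulr_sumr.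
  by apply: eq_bigl => w; rewrite ractM.
rewrite !mxE; case: eqP => [E|_]; last by rewrite mul0r.
by case/eqP: ik; rewrite E enum_valK.
Qed.

(** The coefficients of the two products are sums over the same sets of pairs
    (e, w), grouped by the point x e w on the left and by the element of G which
    is the image of e w on the right; these groupings agree when x separates the
    words e w. *)
Lemma lker_place_conv (X : finRightSet (freeGroup S)) (x : X)
    (es : seq (freeGroup S)) :
  separates x [seq (e * w)%g | e <- es, w <- ws] ->
  lker (place_mx x es *m conv_mx X) = relations es.
Proof.
move=> sep.
have E (k0 : 'I_(size es)) w0 (c : 'rV[A]_(size es)) : w0 \in ws ->
  \sum_(k < size es) \sum_(w <- ws | ract x (nth 1%g es k * w)%g ==
     ract x (nth 1%g es k0 * w0)%g) c 0 k * b w =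
  \sum_(k < size es) \sum_(w <- ws | pr (nth 1%g es k * w)%g ==
     pr (nth 1%g es k0 * w0)%g) c 0 k * b w.
  move=> w0W; apply: eq_bigr => k _; rewrite big_seq_cond [RHS]big_seq_cond.
  apply: eq_bigl => w; case: (boolP (w \in ws)) => //= wW.
  by apply: sep; apply: allpairs_f => //; apply: mem_nth.
apply/seteqP; split=> c /= hc.
  move=> h.
  have [[k0 [w0 [w0W <-]]]|nh] := EM (exists (k0 : 'I_(size es)) w0,
      w0 \in ws /\ pr (nth 1%g es k0 * w0)%g = h).
    rewrite -E //; have /rowP/(_ (enum_rank (ract x (nth 1%g es k0 * w0)%g))) := hc.
    by rewrite place_mx_conv enum_rankK mxE.
  rewrite big1 // => k _; rewrite big_seq_cond big1 // => w /andP[wW /eqP hw].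
  by case: nh; exists k, w.
apply/rowP => j; rewrite place_mx_conv mxE.
have [[k0 [w0 [w0W <-]]]|nh] := EM (exists (k0 : 'I_(size es)) w0,
    w0 \in ws /\ ract x (nth 1%g es k0 * w0)%g = enum_val j).
  by rewrite E.
rewrite big1 // => k _; rewrite big_seq_cond big1 // => w /andP[wW /eqP hw].
by case: nh; exists k, w.
Qed.

Lemma place_mx_entry (X : finRightSet (freeGroup S)) (x : X)
    (es : seq (freeGroup S))
    (c : 'rV[A]_(size es)) (k : 'I_(size es)) :
  separates x es -> uniq (map pr es) ->
  (c *m place_mx x es) 0 (enum_rank (ract x (nth 1%g es k))) = c 0 k.
Proof.
move=> sep ues; rewrite mxE (bigD1 k) //= big1 ?addr0 => [|i ik].
  by rewrite mxE enum_rankK eqxx mulr1.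
rewrite mxE enum_rankK sep ?mem_nth //.
by rewrite -!(nth_map _ 1%g) // nth_uniq ?size_map // (inj_eq val_inj) (negPf ik) mulr0.
Qed.

(** Around x the kernel contains a copy of the relations. *)
Lemma len_relations_le (X : finRightSet (freeGroup S)) (x : X)
    (es : seq (freeGroup S)) :
  uniq (map pr es) -> separates x es ->
  separates x [seq (e * w)%g | e <- es, w <- ws] ->
  (len (relations es) <=
     len (lker (conv_mx X) `&` @supported A _ (translate x es)))%N.
Proof.
move=> ues sep sepw; rewrite -(lker_place_conv sepw).
rewrite -(len_inj (mulmx_linear (place_mx x es))); first last.
- move=> c _ c0; apply/rowP => k.
  by rewrite -(place_mx_entry c k sep ues) c0 !mxE.
- exact: finite_length_rV.
- exact: submodule_lker.
apply: len_mono; first exact: finite_length_rV.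
move=> _ [c /= hc <-]; split; first by rewrite /lker /= -mulmxA.
move=> j; rewrite inE => /hasPn nj; rewrite mxE big1 // => k _.
by rewrite mxE (negPf (nj _ _)) ?mulr0 // mem_nth.
Qed.

(** Around x the image contains the image of the vectors supported on x es, of
    length given by rank-nullity.  The words ds represent all the products e w, so
    this image is supported on x ds. *)
Lemma len_conv_translate (X : finRightSet (freeGroup S)) (x : X)
    (es ds : seq (freeGroup S)) :
  {subset map pr [seq (e * w)%g | e <- es, w <- ws] <= map pr ds} ->
  separates x ([seq (e * w)%g | e <- es, w <- ws] ++ ds) ->
  (size es * len [set: A^o] - len (relations es) <=
     len (rowspace (conv_mx X) `&` @supported A _ (translate x ds)))%N.
Proof.
move=> sub sep.
have sepw : separates x [seq (e * w)%g | e <- es, w <- ws].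
  by move=> u v uW vW; apply: sep; rewrite mem_cat ?uW ?vW.
rewrite -(len_lker_rowspace finA (place_mx x es *m conv_mx X)).
rewrite (lker_place_conv sepw) addKn.
apply: len_mono; first exact: finite_length_rV.
move=> _ [c _ <-]; split; first by exists (c *m place_mx x es); rewrite // mulmxA.
move=> j; rewrite inE => /hasPn nj; rewrite place_mx_conv big1 // => k _.
rewrite big_seq_cond big1 // => w /andP[wW /eqP hj].
have ew : (nth 1 es k * w)%g \in [seq (e * w)%g | e <- es, w <- ws].
  by apply: allpairs_f => //; apply: mem_nth.
have /mapP[d dds Ed] := sub _ (map_f pr ew).
have /eqP Exd : ract x (nth 1 es k * w)%g == ract x d.
  by rewrite sep ?mem_cat ?ew ?dds ?orbT // Ed.
by have := nj d dds; rewrite -Exd hj eqxx.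
Qed.

Lemma good_points_sum (X : finRightSet (freeGroup S)) r c (F : X -> nat) :
  (forall x, x \in good_points X r -> (c <= F x)%N) ->
  (#|good_points X r| * c <= \sum_x F x)%N.
Proof.
move=> h; rewrite -sum_nat_const.
apply: (@leq_trans (\sum_(x in good_points X r) F x)%N); first exact: leq_sum.
by rewrite [leqRHS](bigID (mem (good_points X r))) leq_addr.
Qed.

Lemma len_lker_lower (es : seq (freeGroup S)) : uniq (map pr es) ->
  exists r, forall X : finRightSet (freeGroup S),
  (#|good_points X r| * len (relations es) <= size es * len (lker (conv_mx X)))%N.
Proof.
move=> ues.
have [r hr] := good_points_separate (es ++ [seq (e * w)%g | e <- es, w <- ws]).
exists r => X.
apply: leq_trans (sum_len_supported finA (T := fun x : X => translate x es)
   (submodule_lker _) (card_translate _)).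
apply: good_points_sum => x /hr sep; apply: len_relations_le => // u v uW vW;
  by apply: sep; rewrite mem_cat ?uW ?vW ?orbT.
Qed.

Lemma len_rowspace_lower (es ds : seq (freeGroup S)) :
  {subset map pr [seq (e * w)%g | e <- es, w <- ws] <= map pr ds} ->
  exists r, forall X : finRightSet (freeGroup S),
  (#|good_points X r| * (size es * len [set: A^o] - len (relations es))
     <= size ds * len (rowspace (conv_mx X)))%N.
Proof.
move=> sub.
have [r hr] := good_points_separate ([seq (e * w)%g | e <- es, w <- ws] ++ ds).
exists r => X.
apply: leq_trans (sum_len_supported finA (T := fun x : X => translate x ds)
   (submodule_rowspace _) (card_translate _)).
by apply: good_points_sum => x /hr sep; apply: len_conv_translate.
Qed.

(** Lifts to words of a Foelner set F and of F supp(a): the latter exceeds F by at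
    most a proportion 1 / N.+1. *)
Lemma foelner_words (hG : amenable G) (hS : generates S) (N : nat) :
  exists es ds : seq (freeGroup S),
    [/\ (0 < size es)%N, uniq (map pr es),
        {subset map pr [seq (e * w)%g | e <- es, w <- ws] <= map pr ds}
      & (N.+1 * size ds <= N.+2 * size es)%N].
Proof.
pose lift (g : G) : freeGroup S := sval (cid (hS g)).
have liftK : cancel lift pr by move=> g; apply: (svalP (cid (hS g))).
have mapK s : map pr (map lift s) = s.
  by rewrite -map_comp -[RHS]map_id; apply: eq_map.
pose E := [fset pr w | w in ws]%fset.
have N0 : (0 : rat) < (N.+1%:R)^-1 by rewrite invr_gt0 ltr0n.
have [F F0 hF] := hG E _ N0.
pose B := [fset (x * g)%g | x in F, g in E]%fset.
exists (map lift F), (map lift B).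
rewrite !size_map !mapK.
split.
- by rewrite cardfs_gt0.
- exact: fset_uniq.
- move=> g /mapP[v /allpairsP[[e w] /= [/mapP[x xF ->] wW ->]] ->].
  by rewrite free_to_groupM liftK; apply/imfset2P; exists x => //; exists (pr w) => //; apply: in_imfset.
move: hF; rewrite -/B mulrC ler_pdivlMr ?ltr0n // -natrM ler_nat => hF.
rewrite -(cardfsID F B) mulnDr [leqRHS]mulSn [leqRHS]addnC.
apply: leq_add; last by rewrite mulnC.
by rewrite leq_mul2l fsubset_leq_card ?orbT // fsubsetIr.
Qed.

End Convolution.
End LocalModel.

(** * Convergence of the normalized length of the image *)

Section SoficLimit.
Variables (R : realType) (G : groupType) (S : {fset G}).
Variable X : nat -> finRightSet (freeGroup S).
Hypothesis hX : sofic_approximation R X.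

Lemma sofic_good_ge r (c : R) : c < 1 ->
  \forall n \near \oo, c <= #|good_points (X n) r|%:R / #|X n|%:R.
Proof. by move=> c1; apply: (cvgr_ge _ (hX r)). Qed.

Lemma sofic_card_gt0 : \forall n \near \oo, (0 < #|X n|)%N.
Proof.
have h2 : 2^-1 < 1 :> R by rewrite invf_lt1 ?ltr1n.
near=> n; rewrite lt0n; apply/negP => /eqP x0.
have : 2^-1 <= #|good_points (X n) 0|%:R / #|X n|%:R :> R.
  by near: n; apply: sofic_good_ge.
by rewrite x0 invr0 mulr0 leNgt invr_gt0 ltr0n.
Unshelve. all: end_near.
Qed.

End SoficLimit.

Section Limit.
Variables (R : realType) (A : nzRingType).
Hypothesis finA : finite_length [set: A^o].
Variables (G : groupType) (hG : amenable G) (S : {fset G}) (hS : generates S).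
Variables (ws : seq (freeGroup S)) (b : freeGroup S -> A).

Local Notation pr := (@free_to_group G S).
Local Notation rels es := (@relations G S A ws b es).
Local Notation conv := (@conv_mx G S A ws b).
Local Notation kappa := (len [set: A^o]).

Definition relation_densities : set R :=
  [set q | exists es : seq (freeGroup S),
     [/\ (0 < size es)%N, uniq (map pr es)
       & q = (len (rels es))%:R / (size es)%:R]].

Lemma len_relations_ub es : (len (rels es) <= size es * kappa)%N.
Proof.
rewrite -(len_rVT finA); apply: len_mono => //; exact: finite_length_rV.
Qed.

Lemma relation_densities_ub q : relation_densities q -> 0 <= q <= kappa%:R.
Proof.
move=> [es [s0 _ ->]]; rewrite divr_ge0 ?ler0n //= ler_pdivrMr ?ltr0n //.
by rewrite -natrM ler_nat mulnC len_relations_ub.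
Qed.

Lemma has_sup_relation_densities : has_sup relation_densities.
Proof.
split; last by exists kappa%:R => q /relation_densities_ub/andP[].
by eexists; exists [:: 1%g]; split.
Qed.

(** The final estimate: K and F are the normalized lengths of the kernel and of the
    image, p1 and p2 proportions of good points, q1 and q2 densities of relations
    with supremum s, and d the Foelner ratio.  The first density makes F at most
    kap - s up to e, the second one makes it at least kap - s up to e. *)
Lemma sandwich (kap s q1 q2 p1 p2 K F d e eta : R) :
  0 <= kap -> K + F = kap -> 0 <= K -> 0 <= F ->
  s - e / 2 < q1 -> 0 <= q1 <= kap -> 0 <= q2 <= s -> s <= kap ->
  p1 * q1 <= K -> p2 * (kap - q2) <= d * F -> d <= 1 + eta ->
  1 - eta <= p1 <= 1 -> 1 - eta <= p2 <= 1 -> eta * kap <= e / 2 ->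
  `|kap - s - F| <= e.
Proof.
move=> k0 KF K0 F0 sq /andP[q10 q1k] /andP[q20 q2s] sk pq pd d1.
move=> /andP[p1l p1u] /andP[p2l p2u] ek.
have eta0 : 0 <= eta by lra.
have Fk : F <= kap by lra.
have dF : d * F <= F + eta * kap.
  apply: (@le_trans _ _ ((1 + eta) * F)); first exact: ler_wpM2r.
  by rewrite mulrDl mul1r lerD2l ler_wpM2l.
have h1 : (1 - p1) * q1 <= eta * kap by apply: ler_pM => //; lra.
have h2 : (1 - p2) * (kap - q2) <= eta * kap by apply: ler_pM => //; lra.
by rewrite ler_norml; apply/andP; split; lra.
Qed.

(** The limit is kappa - s, with s the supremum of the densities of relations,
    which involves no sofic approximation. *)
Lemma rowspace_density_limit : exists l : R,
  forall X : nat -> finRightSet (freeGroup S), sofic_approximation R X ->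
  (len (rowspace (conv (X n))))%:R / #|X n|%:R @[n --> \oo] --> l.
Proof.
pose s := sup relation_densities; exists (kappa%:R - s) => X hX.
have hsup := has_sup_relation_densities.
have q_le_s q : relation_densities q -> q <= s by apply: ub_le_sup; case: hsup.
have s_le : s <= kappa%:R.
  by apply: ge_sup; [case: hsup|move=> q /relation_densities_ub/andP[]].
apply/cvgrPdist_le => e e0.
have e20 : 0 < e / 2 by rewrite divr_gt0.
pose eta := e / 2 / (kappa%:R + 1).
have k1 : 0 < kappa%:R + 1 :> R by rewrite ltr_wpDl.
have eta0 : 0 < eta by rewrite divr_gt0.
have etak : eta * kappa%:R <= e / 2.
  by rewrite /eta -mulrA ler_piMr ?(ltW e20) // ler_pdivrMl // mulr1 lerDl.
have [_ [es1 [s1 u1 ->]] sq1] := sup_adherent e20 hsup.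
have [r1 hr1] := len_lker_lower ws b finA u1.
have [N hN] : exists N, N.+1%:R^-1 <= eta.
  exists (Num.truncn (eta^-1)); rewrite invf_ple ?posrE ?ltr0n //.
  by apply: ltW; apply: truncnS_gt.
have [es2 [ds [s2 u2 sub hds]]] := foelner_words ws hG hS N.
have [r2 hr2] := len_rowspace_lower b finA sub.
have eta1 : 1 - eta < 1 by rewrite ltrBlDr ltrDl.
near=> n.
have x0 : (0 < #|X n|)%N by near: n; apply: sofic_card_gt0 hX.
have x0R : 0 < #|X n|%:R :> R by rewrite ltr0n.
have good1 r : #|good_points (X n) r|%:R / #|X n|%:R <= 1 :> R.
  by rewrite ler_pdivrMr // mul1r ler_nat max_card.
have s1R : 0 < (size es1)%:R :> R by rewrite ltr0n.
have s2R : 0 < (size es2)%:R :> R by rewrite ltr0n.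
have d1 : relation_densities ((len (rels es1))%:R / (size es1)%:R) by exists es1.
have d2 : relation_densities ((len (rels es2))%:R / (size es2)%:R) by exists es2.
apply: (@sandwich kappa%:R s ((len (rels es1))%:R / (size es1)%:R)
  ((len (rels es2))%:R / (size es2)%:R)
  (#|good_points (X n) r1|%:R / #|X n|%:R)
  (#|good_points (X n) r2|%:R / #|X n|%:R)
  ((len (lker (conv (X n))))%:R / #|X n|%:R) _
  ((size ds)%:R / (size es2)%:R) e eta) => //.
- by rewrite -mulrDl -natrD len_lker_rowspace // natrM mulrAC divff ?mul1r ?gt_eqF.
- exact: relation_densities_ub.
- by rewrite q_le_s // andbT; case/andP: (relation_densities_ub d2).
- rewrite mulf_div ler_pdivrMr ?mulr_gt0 // mulrA divfK ?gt_eqF //.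
  by rewrite -!natrM ler_nat [leqRHS]mulnC hr1.
- have -> : kappa%:R - (len (rels es2))%:R / (size es2)%:R =
      (size es2 * kappa - len (rels es2))%N%:R / (size es2)%:R :> R.
    rewrite natrB ?len_relations_ub // natrM mulrBl; congr (_ - _).
    by rewrite mulrAC divff ?mul1r ?gt_eqF.
  rewrite !mulf_div [(size es2)%:R * _]mulrC ler_pM2r ?invr_gt0 ?mulr_gt0 //.
  by rewrite -!natrM ler_nat hr2.
- apply: (@le_trans _ _ (1 + N.+1%:R^-1)); last by rewrite lerD2l.
  rewrite ler_pdivrMr // -(@ler_pM2l _ N.+1%:R) ?ltr0n // mulrA mulrDr mulr1.
  by rewrite divff ?pnatr_eq0 // natr1 -!natrM ler_nat.
- rewrite good1 andbT; near: n; exact: sofic_good_ge hX _ _ _.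
- rewrite good1 andbT; near: n; exact: sofic_good_ge hX _ _ _.
Unshelve. all: end_near.
Qed.

End Limit.

(** * Discrete valuation domains and Smith normal form *)

Section Quotient.
Local Open Scope quotient_scope.

Lemma principal_quotient (O : comNzRingType) (p : O) :
  ~ (exists c, 1 = c * p) ->
  exists (A : comNzRingType) (h : {rmorphism O -> A}),
    (forall y, exists x, h x = y) /\ (forall x, h x = 0 <-> exists c, x = c * p).
Proof.
move=> np.
pose P : {pred O} := fun x => `[< exists c, x = c * p >].
have idP : idealr_closed P.
  split; first by apply/asboolP; exists 0; rewrite mul0r.
    by apply/asboolP.
  move=> a _ _ /asboolP[c ->] /asboolP[d ->]; apply/asboolP.
  by exists (a * c + d); rewrite mulrDl mulrA.
pose I : idealr O := HB.pack (P : O -> bool) (isIdealr.Build O P idP).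
pose A : comNzRingType := {ideal_quot I}.
exists A, (\pi_{ideal_quot I} : {rmorphism O -> {ideal_quot I}}); split.
  by move=> y; exists (repr y); apply: reprK.
move=> x; rewrite -(rmorph0 (\pi_{ideal_quot I} : {rmorphism O -> {ideal_quot I}})).
split=> [/eqP|hx].
  by rewrite -Quotient.idealrBE subr0 => /asboolP.
by apply/eqP; rewrite -Quotient.idealrBE subr0; apply/asboolP.
Qed.

End Quotient.

Section Ideals.
Variable O : comNzRingType.

Lemma ideal_eqP (I J : ideal O) : (forall x, ideal_set I x <-> ideal_set J x) -> I = J.
Proof. by move=> IJ; apply: ideal_ext; apply/seteqP; split=> x /IJ. Qed.

Lemma ideal_has1 (I : ideal O) : ideal_set I 1 -> I = unit_ideal O.
Proof.
move=> I1; apply: ideal_eqP => x; split=> // _.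
by have [_ _ /(_ x _ I1)] := ideal_setP I; rewrite mulr1.
Qed.

(** Zorn's lemma for the ideals that contain x and not 1.  The empty set is added
    to them so that the empty chain has an upper bound. *)
Lemma exists_maximal_ideal (x : O) : ~ (exists c, 1 = c * x) ->
  exists2 M : ideal O, ideal_set M x & maximal_ideal M.
Proof.
move=> nx; pose P : set (set O) :=
  [set I | I = set0 \/ [/\ is_ideal I, I x & ~ I 1]].
have [|A [PA maxA]] := @Zorn_bigcup _ P.
  move=> F FP tot.
  have [[X0 [FX0 X0x]]|nF] := EM (exists X, F X /\ X x); last first.
    left; apply/seteqP; split=> // y [X FX Xy].
    by case: (FP _ FX) => [E|[_ Xx _]]; [rewrite E in Xy|case: nF; exists X].
  right; split; first last.
  - move=> [X FX X1]; case: (FP _ FX) => [E|[]//]; by rewrite E in X1.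
  - by exists X0.
  have FI X : F X -> X !=set0 -> is_ideal X.
    by move=> /FP[->|[//]]; case.
  split.
  - by exists X0 => //; case: (FI _ FX0); [exists x|].
  - move=> y z [Y FY Yy] [Z FZ Zz].
    have [sYZ|sZY] := tot _ _ FY FZ.
      by exists Z => //; case: (FI _ FZ) => [|_ D _]; [exists z|apply: D => //; apply: sYZ].
    by exists Y => //; case: (FI _ FY) => [|_ D _]; [exists y|apply: D => //; apply: sZY].
  - by move=> c y [Y FY Yy]; exists Y => //; case: (FI _ FY) => [|_ _]; [exists y|apply].
have [A0|[iA Ax nA1]] := PA.
  exfalso; apply: (maxA (ideal_set (principal x))).
    by rewrite A0; split=> // /(_ x); apply; exists 1; rewrite mul1r.
  right; split; [exact: ideal_setP|by exists 1; rewrite mul1r|].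
  by move=> [c c1]; apply: nx; exists c.
exists (Ideal iA) => //; split; first by move=> E; apply: nA1; move: (congr1 (fun J => ideal_set J 1) E) => /= ->.
move=> J /= AJ; have [J1|nJ1] := EM (ideal_set J 1); first by right; apply: ideal_has1.
left; apply: ideal_ext => /=; apply/seteqP; split=> //.
apply: contrapT => nJA; apply: (maxA (ideal_set J)); first by split.
by right; split; [exact: ideal_setP|exact: AJ|].
Qed.

Lemma ideal_mul_principal (x y : O) :
  ideal_mul (principal x) (principal y) = principal (x * y).
Proof.
apply: ideal_eqP => z; split=> /=.
  move=> [s hs ->].
  elim: s hs => [|p s IH] hs; first by exists 0; rewrite big_nil mul0r.
  have [[c pc] [d pd]] := hs p (mem_head _ _); rewrite big_cons.
  have [e ->] : exists e, \sum_(q <- s) q.1 * q.2 = e * (x * y).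
    by apply: IH => q qs; apply: hs; rewrite inE qs orbT.
  exists (c * d + e).
  by rewrite pc pd mulrDl mulrACA.
move=> [c ->]; exists [:: (c * x, y)]; last by rewrite big_seq1 mulrA.
by move=> p; rewrite inE => /eqP -> /=; split; [exists c|exists 1; rewrite mul1r].
Qed.

Lemma ideal_exp_principal (x : O) k : ideal_exp (principal x) k = principal (x ^+ k).
Proof.
elim: k => [|k IH]; first by apply/esym/ideal_has1; exists 1; rewrite mul1r.
by rewrite exprS -ideal_mul_principal -IH.
Qed.

End Ideals.

Section Uniformizer.
Variables (O : idomainType) (m : ideal O).
Hypothesis hO : discrete_valuation_domain m.
Variable pi : O.
Hypothesis hpi : m = principal pi.

Lemma pi_proper c : 1 <> c * pi.
Proof.
case: hO => _ [[[mu _] _] _] E; apply: mu; apply: ideal_has1.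
by rewrite hpi; exists c.
Qed.

Lemma pi_neq0 : pi != 0.
Proof. by apply/eqP => E; case: hO => _ [[_ []]]; rewrite hpi E. Qed.

(** A non-unit x different from 0 lies in a maximal ideal, which is not 0 and hence
    is m by uniqueness. *)
Lemma dvd_unit x : (exists c, x = c * pi) \/ x \is a GRing.unit.
Proof.
have [[c c1]|nu] := EM (exists c, 1 = c * x).
  by right; apply/unitrP; exists c; rewrite [x * c]mulrC -c1.
left; have [->|x0] := eqVneq x 0; first by exists 0; rewrite mul0r.
have [M Mx maxM] := exists_maximal_ideal nu.
have Mm : m = M.
  case: hO => _ [_]; apply; split=> // E; move: Mx; rewrite E => -[c].
  by rewrite mulr0 => /eqP; rewrite (negPf x0).
by move: Mx; rewrite -Mm hpi.
Qed.

(** Let g generate the ideal of all y with y pi^i in (x) for some i.  If every power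
    of pi divides x, then g is a multiple of g pi, so g = 0, and x is a multiple
    of g. *)
Lemma pi_adic_separated x : (forall i, exists c, x = c * pi ^+ i) -> x = 0.
Proof.
move=> dx.
have idI : is_ideal [set y | exists i c, y * pi ^+ i = c * x].
  split=> /=; first by exists 0%N, 0; rewrite !mul0r.
  - move=> y z [i [c yc]] [j [d zd]]; exists (i + j)%N, (c * pi ^+ j + d * pi ^+ i).
    transitivity (y * pi ^+ i * pi ^+ j + z * pi ^+ j * pi ^+ i).
      by rewrite exprD; ring.
    by rewrite yc zd; ring.
  - by move=> e y [i [c yc]]; exists i, (e * c); rewrite -[RHS]mulrA -yc mulrA.
case: hO => /(_ (Ideal idI))[g Ig] _.
have inI y : (exists i c, y * pi ^+ i = c * x) <-> exists c, y = c * g.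
  by move: (congr1 (fun J => ideal_set J y) Ig) => /= ->.
have [i [c gc]] : exists i c, g * pi ^+ i = c * x by apply/inI; exists 1; rewrite mul1r.
have [d xd] := dx i.+1.
have [e de] : exists e, d = e * g.
  by apply/inI; exists i.+1, 1; rewrite mul1r.
have : g * pi ^+ i * (1 - c * e * pi) = 0.
  rewrite mulrBr mulr1 [in X in X - _]gc {1}xd de exprS; ring.
move=> /eqP; rewrite !mulf_eq0 expf_eq0 (negPf pi_neq0) andbF orbF subr_eq0.
case/orP => [/eqP g0|/eqP/pi_proper//].
have [f ->] : exists f, x = f * g by apply/inI; exists 0%N, 1; rewrite expr0 mulr1 mul1r.
by rewrite g0 mulr0.
Qed.

Lemma pi_dvd_le u i j c : u \is a GRing.unit -> u * pi ^+ i = c * pi ^+ j -> (j <= i)%N.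
Proof.
move=> uu E; rewrite leqNgt; apply/negP => ij.
apply: (@pi_proper (u^-1 * c * pi ^+ (j - i).-1)).
apply: (@mulIf _ (pi ^+ i)); first by rewrite expf_neq0 // pi_neq0.
have -> : u^-1 * c * pi ^+ (j - i).-1 * pi * pi ^+ i = u^-1 * (c * pi ^+ j).
  by rewrite -!mulrA -!exprS -exprD; congr (_ * (_ * pi ^+ _)); lia.
by rewrite -E mulKr // mul1r.
Qed.

Lemma last_index_of_bounded (P : nat -> Prop) b : P 0%N -> (forall i, P i -> (i <= b)%N) ->
  exists2 i, P i & ~ P i.+1.
Proof.
move=> P0 Pb; have exP : exists i, `[< P i >] by exists 0%N; apply/asboolP.
have ubP i : `[< P i >] -> (i <= b)%N by move=> /asboolP/Pb.
case: (ex_maxnP exP ubP) => i /asboolP Pi mi; exists i => // /asboolP/mi.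
by rewrite ltnn.
Qed.

Lemma unit_pi_power x : x != 0 ->
  exists u i, u \is a GRing.unit /\ x = u * pi ^+ i.
Proof.
move=> x0; have [b nb] : exists b, ~ exists c, x = c * pi ^+ b.
  by apply/existsNP => /pi_adic_separated/eqP; rewrite (negPf x0).
have [||i [u xu] ni] := @last_index_of_bounded (fun i => exists c, x = c * pi ^+ i) b.
- by exists x; rewrite mulr1.
- move=> i [c xc]; rewrite leqNgt; apply/negP => bi; apply: nb.
  by exists (c * pi ^+ (i - b)); rewrite -mulrA -exprD subnK // ltnW.
exists u, i; split=> //; case: (dvd_unit u) => // -[c uc].
by case: ni; exists c; rewrite exprS mulrA -uc.
Qed.

Lemma ideal_cases (I : ideal O) :
  I = zero_ideal O \/ exists j, I = ideal_exp m j.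
Proof.
case: hO => /(_ I)[x ->] _; have [->|/unit_pi_power[u [i [uu ->]]]] := eqVneq x 0.
  by left.
right; exists i; rewrite hpi ideal_exp_principal; apply: ideal_eqP => y; split=> -[c ->].
  by exists (c * u); rewrite mulrA.
by exists (c * u^-1); rewrite mulrA divrK.
Qed.

Lemma ideal_exp_inj i j : ideal_exp m i = ideal_exp m j -> i = j.
Proof.
rewrite hpi !ideal_exp_principal => E.
have sub k l : principal (pi ^+ k) = principal (pi ^+ l) -> (l <= k)%N.
  move=> E'; have : ideal_set (principal (pi ^+ k)) (pi ^+ k) by exists 1; rewrite mul1r.
  by rewrite E' => -[c]; rewrite -[X in X = _]mul1r => /pi_dvd_le -> //; apply: unitr1.
by apply/eqP; rewrite eqn_leq !sub.
Qed.

Lemma ideal_exp_neq0 i : ideal_exp m i <> zero_ideal O.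
Proof.
rewrite hpi ideal_exp_principal => E.
have : ideal_set (principal (pi ^+ i)) (pi ^+ i) by exists 1; rewrite mul1r.
by rewrite E => -[c]; rewrite mulr0 => /eqP; rewrite expf_eq0 (negPf pi_neq0) andbF.
Qed.

Lemma smith_mx_cons n k ks :
  smith_mx pi n.+1 (k :: map (addn k) ks) =
  pi ^+ k *: block_mx 1%:M 0 0 (smith_mx pi n ks) :> 'M[O]_(1 + n).
Proof.
apply/matrixP => i j; rewrite -(@fintype.splitK 1 n i) -(@fintype.splitK 1 n j).
case: (fintype.split i) => i'; case: (fintype.split j) => j'; rewrite /unsplit mxE [RHS]mxE;
  rewrite ?block_mxEul ?block_mxEur ?block_mxEdl ?block_mxEdr ?[in RHS]mxE ?ord1.
- by rewrite eqxx mulr1.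
- by rewrite mulr0.
- by rewrite mulr0.
rewrite -!(inj_eq val_inj) /= eqn_add2l !add1n size_map ltnS /=.
case: ifP => [/andP[_ si]|]; last by rewrite mulr0.
by rewrite (nth_map 0%N) // exprD.
Qed.

(** A unit in the corner clears its row and its column. *)
Lemma smith_pivot n (B : 'M[O]_(1 + n)) : B 0 0 \is a GRing.unit ->
  exists (P Q : 'M[O]_(1 + n)) C, [/\ P \in unitmx, Q \in unitmx
    & P *m B *m Q = block_mx 1%:M 0 0 C].
Proof.
move=> bu; set b := B 0 0 in bu.
have ulB : ulsubmx B = b%:M.
  by apply/matrixP => i j; rewrite !ord1 !mxE mulr1n; congr (B _ _); apply: val_inj.
pose dl := dlsubmx B; pose ur := ursubmx B.
exists (block_mx (b^-1)%:M 0 (- (b^-1 *: dl)) 1%:M).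
exists (block_mx 1%:M (- (b^-1 *: ur)) 0 1%:M).
exists (drsubmx B - b^-1 *: (dl *m ur)); split.
- by rewrite unitmxE det_lblock det1 mulr1 det_scalar1 unitrV.
- by rewrite unitmxE det_ublock !det1 mulr1 unitr1.
rewrite -[in LHS](submxK B) ulB -/dl -/ur !mulmx_block !mul0mx !mulmx0 !mul1mx !mulmx1.
rewrite !addr0 -scalar_mxM mulVr // mul1mx.
rewrite !mulNmx !mulmxN -!scalemxAl -!scalemxAr !mul_mx_scalar !mul_scalar_mx !scalerA mulVr //.
rewrite scale1r; congr block_mx.
- by rewrite addrC subrr.
- by rewrite addrC subrr.
by rewrite addNr mul0mx scaler0 oppr0 add0r addrC.
Qed.

(** Divide A by the largest power pi^k dividing all its entries: some entry becomes
    a unit, which is moved to the corner and used as a pivot.  The exponents of the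
    remaining block are shifted by k, which keeps the list sorted. *)
Lemma smith_exists n (A : 'M[O]_n) : exists ks, is_smith_normal_form pi A ks.
Proof.
elim: n A => [|n IH] A.
  exists [::]; split=> //; exists 1%:M, 1%:M; split; try exact: unitmx1.
  by rewrite flatmx0 [RHS]flatmx0.
have [->|A0] := eqVneq A 0.
  exists [::]; split=> //; exists 1%:M, 1%:M; split; try exact: unitmx1.
  by rewrite mulmx0 mul0mx; apply/matrixP => i j; rewrite !mxE andbF.
have [i1 [j1 a0]] : exists i j, A i j != 0.
  apply: contrapT => nA; case/eqP: A0; apply/matrixP => i j; rewrite mxE.
  by apply/eqP/negPn/negP => aij; apply: nA; exists i, j.
have [u [v [uu Auv]]] := unit_pi_power a0.
have [||k Ak nAk] := @last_index_of_bounded (fun k => forall i j, exists c, A i j = c * pi ^+ k) v.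
- by move=> i j; exists (A i j); rewrite mulr1.
- by move=> k /(_ i1 j1)[c]; rewrite Auv => /pi_dvd_le; apply.
have [B AB] : exists B : 'M[O]_n.+1, A = pi ^+ k *: B.
  exists (\matrix_(i, j) sval (cid (Ak i j))); apply/matrixP => i j.
  by rewrite !mxE mulrC; case: cid.
have [i0 [j0 Bu]] : exists i j, B i j \is a GRing.unit.
  apply: contrapT => nB; apply: nAk => i j.
  case: (dvd_unit (B i j)) => [[c Bc]|Bu]; last by case: nB; exists i, j.
  by exists c; rewrite AB mxE Bc exprSr mulrCA.
have [|P [Q [C [Pu Qu PQ]]]] := @smith_pivot n (xrow i0 0 (xcol j0 0 B)).
  by rewrite !mxE !perm.tpermR.
have [ks [sks szk [P1 [Q1 [P1u Q1u E1]]]]] := IH C.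
have bu (M : 'M[O]_n) : M \in unitmx ->
    (block_mx 1%:M 0 0 M : 'M[O]_(1 + n)) \in unitmx.
  by rewrite !unitmxE det_lblock det1 mul1r.
exists (k :: map (addn k) ks); split.
- rewrite /= (path_sortedE leq_trans) sorted_map; apply/andP; split.
    by apply/allP => _ /mapP[x _ ->]; apply: leq_addr.
  by apply: sub_sorted sks => x y; rewrite /= leq_add2l.
- by rewrite /= size_map.
exists (block_mx 1%:M 0 0 P1 *m P *m tperm_mx i0 0 : 'M[O]_(1 + n)).
exists (tperm_mx j0 0 *m Q *m block_mx 1%:M 0 0 Q1 : 'M[O]_(1 + n)); split.
- by rewrite !unitmx_mul bu // Pu unitmx_perm.
- by rewrite !unitmx_mul bu // Qu unitmx_perm.
rewrite smith_mx_cons AB -scalemxAr -scalemxAl; congr (_ *: _).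
have -> : block_mx 1%:M 0 0 P1 *m P *m tperm_mx i0 0 *m B *m
     (tperm_mx j0 0 *m Q *m block_mx 1%:M 0 0 Q1) =
   block_mx 1%:M 0 0 P1 *m (P *m xrow i0 0 (xcol j0 0 B) *m Q) *m block_mx 1%:M 0 0 Q1.
  by rewrite xrowE xcolE !mulmxA.
rewrite PQ !mulmx_block !mul0mx !mulmx0 !mul1mx !mulmx1 !addr0 !add0r.
by rewrite mul0mx E1.
Qed.

End Uniformizer.

(** * Lengths of images in terms of Smith exponents *)

Section SmithLength.
Variables (O : idomainType) (pi : O) (A : comNzRingType).
Hypothesis finA : finite_length [set: A^o].
Variable h : {rmorphism O -> A}.

Lemma len_rowspace_smith n (M : 'M[O]_n) ks (L : nat -> nat) :
  (forall j, len (range (fun c : A => c * h (pi ^+ j) : A^o)) = L j) ->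
  is_smith_normal_form pi M ks ->
  len (rowspace (map_mx h M)) = (\sum_(x <- ks) L x)%N.
Proof.
move=> hL [_ szk [P [Q [Pu Qu PMQ]]]].
rewrite -(@len_rowspace_equiv _ finA _ (map_mx h P) (map_mx h (invmx P)) _
  (map_mx h Q) (map_mx h (invmx Q))); first last.
- by rewrite -map_mxM mulmxV // map_mx1.
- by rewrite -map_mxM mulVmx // map_mx1.
rewrite -!map_mxM PMQ.
pose d (i : 'I_n) := h (if (i < size ks)%N then pi ^+ nth 0%N ks i else 0).
have -> : map_mx h (smith_mx pi n ks) =
    \matrix_(i, j) (if i == j then d i else 0).
  apply/matrixP => i j; rewrite !mxE /d; case: eqP => _ //=; exact: rmorph0.
rewrite len_rowspace_diag // (big_nth 0%N) big_mkord.
rewrite (big_ord_widen n (fun i => L (nth 0%N ks i))) // [RHS]big_mkcond.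
apply: eq_bigr => i _; rewrite /d; case: ifP => _; first exact: hL.
rewrite -[RHS](len0 A^o); congr len; apply/seteqP; split=> [_ [c _ <-]|_ ->] /=.
  by rewrite rmorph0 mulr0.
by exists 0; rewrite // mul0r.
Qed.

End SmithLength.

Section FieldLength.
Variable K : fieldType.

Lemma submodule_field (U : set K^o) x : submodule U -> U x -> x != 0 -> U = setT.
Proof.
move=> [U0 UD] Ux x0; apply/seteqP; split=> // y _.
have := UD (y / x) _ _ Ux U0; rewrite addr0; congr U.
exact: divfK.
Qed.

Lemma has_chain_field : ~ has_chain 2 [set: K^o].
Proof.
move=> [U [sU [_ nU]] [W [[W0 _] [_ nW]] _]]; apply: nW => x Ux.
have [->//|x0] := eqVneq x 0.
by case: nU; rewrite (submodule_field sU Ux x0).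
Qed.

Lemma finite_length_field : finite_length [set: K^o].
Proof. by exists 2%N; apply: has_chain_field. Qed.

Lemma len_field_range (d : K) : d != 0 -> len (range (fun c : K => c * d : K^o)) = 1%N.
Proof.
move=> d0; have -> : range (fun c : K => c * d : K^o) = setT.
  by apply/seteqP; split=> // y _; exists (y / d); rewrite // divfK.
apply: len_eq; last exact: has_chain_field.
exists [set 0] => //; split; last first.
  by split=> // /(_ 1 I) /eqP; rewrite oner_eq0.
by split=> // c _ _ -> ->; rewrite scaler0 addr0.
Qed.

End FieldLength.

Section TruncatedLength.
Variables (O : idomainType) (m : ideal O).
Hypothesis hO : discrete_valuation_domain m.
Variable pi : O.
Hypothesis hpi : m = principal pi.
Variables (k : nat) (A : comNzRingType) (h : {rmorphism O -> A}).
Hypothesis h_surj : forall y, exists x, h x = y.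
Hypothesis h_ker : forall x, h x = 0 <-> exists c, x = c * pi ^+ k.

Local Notation mult j := (range (fun c : A => c * h (pi ^+ j) : A^o)).

Lemma submodule_mult j : submodule (mult j).
Proof.
split; first by exists 0; rewrite // mul0r.
move=> c _ _ [x _ <-] [y _ <-]; exists (c * x + y) => //.
by rewrite mulrDl -mulrA.
Qed.

(** The preimage in O of an ideal of O/pi^k is a power of m, not beyond m^k. *)
Lemma submodule_trunc (U : set A^o) : submodule U ->
  exists2 j, (j <= k)%N & U = mult j.
Proof.
move=> [U0 UD].
have UM c x : U x -> U (c * x) by move=> Ux; have := UD c x 0 Ux U0; rewrite addr0.
have idI : is_ideal [set x | U (h x)].
  split=> /=; first by rewrite rmorph0.
  - by move=> x y Ux Uy; rewrite rmorphD -[h x]mul1r; apply: UD.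
  - by move=> c x Ux; rewrite rmorphM; apply: UM.
have Uk : U (h (pi ^+ k)).
  by have /h_ker -> : exists c, pi ^+ k = c * pi ^+ k by exists 1; rewrite mul1r.
have inI (J : ideal O) : Ideal idI = J -> forall x, U (h x) <-> ideal_set J x.
  by move=> <-.
case: (ideal_cases hO hpi (Ideal idI)) => [/inI I0|[j]].
  move: Uk => /I0[c]; rewrite mulr0 => /eqP.
  by rewrite expf_eq0 (negPf (pi_neq0 hO hpi)) andbF.
rewrite hpi ideal_exp_principal => /inI Ij; exists j.
  move: Uk => /Ij[c]; rewrite -[X in X = _]mul1r => /(pi_dvd_le hO hpi); apply.
  exact: unitr1.
apply/seteqP; split=> [y Uy|_ [c _ <-]].
  have [x xy] := h_surj y; move: Uy; rewrite -xy => /Ij[c ->].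
  by exists (h c); rewrite // rmorphM.
by apply: UM; apply/Ij; exists 1; rewrite mul1r.
Qed.

Lemma mult_subset i j : (j <= i)%N -> mult i `<=` mult j.
Proof.
move=> ji _ [c _ <-]; exists (c * h (pi ^+ (i - j))) => //.
by rewrite -mulrA -rmorphM -exprD subnK.
Qed.

(** If pi^j were x pi^(j+1) modulo pi^k, then pi^k would divide (1 - x pi) pi^j,
    where 1 - x pi is a unit. *)
Lemma mult_proper j : (j < k)%N -> mult j.+1 `<` mult j.
Proof.
move=> jk; split; first exact: mult_subset.
move=> /(_ (h (pi ^+ j)))[]; first by exists 1; rewrite // mul1r.
move=> c _; have [x <-] := h_surj c; rewrite -rmorphM => E.
have /h_ker[d] : h (pi ^+ j - x * pi ^+ j.+1) = 0 by rewrite rmorphB E subrr.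
have -> : pi ^+ j - x * pi ^+ j.+1 = (1 - x * pi) * pi ^+ j.
  by rewrite mulrBl mul1r exprS mulrA.
case: (dvd_unit hO hpi (1 - x * pi)) => [[e E1]|uu].
  exfalso; apply: (@pi_proper _ _ hO _ hpi (e + x)).
  by rewrite mulrDl -E1 subrK.
by move=> /(pi_dvd_le hO hpi uu); rewrite leqNgt jk.
Qed.

Lemma has_chain_mult_ub t j : has_chain t (mult j) -> (j <= k)%N -> (t <= k - j)%N.
Proof.
elim: t j => // t IH j [U [/submodule_trunc[i ik ->] [_ nji]] /IH/(_ ik) ti] jk.
have ji : (j < i)%N by rewrite ltnNge; apply/negP => /mult_subset.
move: ti ji jk ik; lia.
Qed.

Lemma has_chain_mult_lb t j : (t + j <= k)%N -> has_chain t (mult j).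
Proof.
elim: t j => // t IH j tjk; exists (mult j.+1); last by apply: IH; rewrite addnS.
split; first exact: submodule_mult.
by apply: mult_proper; lia.
Qed.

Lemma mult0 : mult 0 = setT.
Proof. by apply/seteqP; split=> // c _; exists c; rewrite // rmorph1 mulr1. Qed.

Lemma finite_length_trunc : finite_length [set: A^o].
Proof.
exists k.+1; rewrite -mult0 => /has_chain_mult_ub/(_ isT).
by rewrite subn0 ltnn.
Qed.

Lemma len_mult j : len (mult j) = (k - j)%N.
Proof.
have [jk|kj] := leqP j k.
  apply: len_eq; first by apply: has_chain_mult_lb; rewrite subnK.
  by move=> /has_chain_mult_ub/(_ jk); rewrite ltnn.
rewrite (eqP (ltnW kj)) -[RHS](len0 A^o); congr len; apply/seteqP.
have /h_ker -> : exists c, pi ^+ j = c * pi ^+ k.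
  by exists (pi ^+ (j - k)); rewrite -exprD subnK // ltnW.
split=> [_ [c _ <-]|_ ->] /=; first by rewrite mulr0.
by exists 0; rewrite // mul0r.
Qed.

End TruncatedLength.

(** For fixed x the function max(k - x, 0) of k is affine except for a change of
    slope from 0 to 1 at k = x.  At j = 0 the truncated predecessor is harmless:
    the terms for j and j.-1 both vanish. *)
Lemma count_second_difference (ks : seq nat) j :
  (count_mem j ks + 2 * \sum_(x <- ks) (j - x) =
   \sum_(x <- ks) (j.+1 - x) + \sum_(x <- ks) (j.-1 - x))%N.
Proof.
elim: ks => [|x ks IH]; first by rewrite !big_nil.
rewrite !big_cons /= mulnDr addnACA IH [RHS]addnACA; congr (_ + _)%N.
by case: eqP => [->|]; lia.
Qed.

(** * The limit of the spectral measures *)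

Section Main.
Variables (R : realType) (O : idomainType) (m : ideal O).
Hypothesis hO : discrete_valuation_domain m.
Variable pi : O.
Hypothesis hpi : m = principal pi.
Variables (G : groupType) (hG : amenable G) (S : {fset G}) (hS : generates S).
Variable a : {fsfun freeGroup S -> O with 0}.

Local Notation exponents X := (smith_exponents pi (rmul_mx X a)).

Lemma smith_exponentsP n (M : 'M[O]_n) :
  is_smith_normal_form pi M (smith_exponents pi M).
Proof. exact: xgetPex (smith_exists hO hpi M). Qed.

Lemma map_rmul_mx (A : comNzRingType) (h : {rmorphism O -> A})
    (X : finRightSet (freeGroup S)) :
  map_mx h (rmul_mx X a) = conv_mx (finsupp a) (fun w => h (a w)) X.
Proof. by apply/matrixP => i j; rewrite !mxE rmorph_sum. Qed.

Lemma smith_sum_limit (A : comNzRingType) (h : {rmorphism O -> A})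
    (L : nat -> nat) : finite_length [set: A^o] ->
  (forall j, len (range (fun c : A => c * h (pi ^+ j) : A^o)) = L j) ->
  exists l : R, forall X : nat -> finRightSet (freeGroup S),
    sofic_approximation R X ->
    (\sum_(x <- exponents (X n)) L x)%:R / #|X n|%:R @[n --> \oo] --> l.
Proof.
move=> finA hL.
have [l hl] := rowspace_density_limit R finA hG hS (finsupp a) (fun w => h (a w)).
exists l => X /hl; apply: cvg_trans; apply: near_eq_cvg; apply: nearW => n.
by rewrite -map_rmul_mx (len_rowspace_smith finA hL (smith_exponentsP _)).
Qed.

Lemma truncated_limit k : exists l : R,
  forall X : nat -> finRightSet (freeGroup S), sofic_approximation R X ->
    (\sum_(x <- exponents (X n)) (k - x))%:R / #|X n|%:R @[n --> \oo] --> l.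
Proof.
case: k => [|k].
  exists 0 => X _; under eq_fun do rewrite big1 // mul0r.
  exact: cvg_cst.
have [|A [h [h_surj h_ker]]] := @principal_quotient O (pi ^+ k.+1).
  by move=> [c]; rewrite exprSr mulrA => /(pi_proper hO hpi).
apply: (@smith_sum_limit A h (fun x => (k.+1 - x)%N)).
  exact: (finite_length_trunc hO hpi h_surj h_ker).
exact: (len_mult hO hpi h_surj h_ker).
Qed.

Lemma rank_limit : exists l : R,
  forall X : nat -> finRightSet (freeGroup S), sofic_approximation R X ->
    (size (exponents (X n)))%:R / #|X n|%:R @[n --> \oo] --> l.
Proof.
have [|j|l hl] := @smith_sum_limit {fraction O} (@tofrac O) (fun=> 1%N).
- exact: finite_length_field.
- by rewrite len_field_range // tofrac_eq0 expf_neq0 // (pi_neq0 hO hpi).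
exists l => X /hl; apply: cvg_trans; apply: near_eq_cvg; apply: nearW => n.
by rewrite sum1_size.
Qed.

Lemma nu_singleton (X : finRightSet (freeGroup S)) (I : ideal O) :
  nu R m pi X a [set I] =
  ((\sum_(i < #|X|) (smith_ideal m pi X a i == I))%N%:R / #|X|%:R)%:E.
Proof.
transitivity ((#|X|%:R^-1 : R)%:E *
    \sum_(i < #|X|) ((smith_ideal m pi X a i == I)%:R)%:E)%E.
  (* The decidable equality of ideals is the truth value of their equality, so
     the two sides are the same sum of indicators. *)
  by [].
by rewrite sumEFin -EFinM mulrC natr_sum.
Qed.

Lemma nu_power (X : finRightSet (freeGroup S)) j :
  nu R m pi X a [set ideal_exp m j] =
  ((count_mem j (exponents X))%:R / #|X|%:R)%:E.
Proof.
have [_ szk _] := smith_exponentsP (rmul_mx X a).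
rewrite nu_singleton; congr (_%:R / _)%:E.
transitivity (\sum_(i < size (exponents X)) (nth 0 (exponents X) i == j))%N.
  rewrite (big_ord_widen _ (fun i => nth 0%N (exponents X) i == j : nat) szk).
  rewrite [RHS]big_mkcond; apply: eq_bigr => i _; rewrite /smith_ideal.
  case: ifP => _; last by case: eqP => // /esym/(ideal_exp_neq0 hO hpi).
  by case: eqP => [/(ideal_exp_inj hO hpi)->|]; case: eqP => // ->.
rewrite -sum1_count [RHS]big_mkcond (big_nth 0%N) big_mkord.
by apply: eq_bigr => i _ /=; case: eqP.
Qed.

Lemma nu_zero (X : finRightSet (freeGroup S)) : (0 < #|X|)%N ->
  nu R m pi X a [set zero_ideal O] = (1 - (size (exponents X))%:R / #|X|%:R)%:E.
Proof.
move=> x0; have [_ szk _] := smith_exponentsP (rmul_mx X a).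
rewrite nu_singleton; congr EFin.
have sizeE : (\sum_(i < #|X|) (i < size (exponents X)) = size (exponents X))%N.
  transitivity (\sum_(i < size (exponents X)) 1)%N; last first.
    by rewrite sum1_card card_ord.
  rewrite (big_ord_widen _ (fun=> 1%N) szk) [RHS]big_mkcond.
  by apply: eq_bigr => i _; case: ifP.
have E : (\sum_(i < #|X|) (smith_ideal m pi X a i == zero_ideal O)
    + size (exponents X) = #|X|)%N.
  rewrite -[X in (_ + X)%N]sizeE -big_split /=.
  transitivity (\sum_(i < #|X|) 1)%N; last by rewrite sum1_card card_ord.
  apply: eq_bigr => i _; rewrite /smith_ideal.
  case: ifP => _; last by rewrite eqxx.
  by case: eqP => // /(ideal_exp_neq0 hO hpi).
have x0R : #|X|%:R != 0 :> R by rewrite pnatr_eq0 -lt0n.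
apply: (mulIf x0R); rewrite mulrBl !divfK // mul1r; apply/eqP.
by rewrite eq_sym subr_eq -natrD E.
Qed.

End Main.

Theorem mainTheorem2 (R : realType)
  (O : idomainType) (m : ideal O) (hO : discrete_valuation_domain m)
  (pi : O) (hpi : m = principal pi)
  (G : groupType) (hG : amenable G) (S : {fset G}) (hS : generates S)
  (a : {fsfun freeGroup S -> O with 0}) (I : ideal O) :
  exists l : R, forall X : nat -> finRightSet (freeGroup S),
    sofic_approximation R X ->
    nu R m pi (X n) a [set I] @[n --> \oo] --> l%:E.
Proof.
case: (ideal_cases hO hpi I) => [->|[j ->]].
  have [l hl] := rank_limit R hO hpi hG hS a; exists (1 - l) => X hX.
  have hcvg : (1 - (size (smith_exponents pi (rmul_mx (X n) a)))%:R / #|X n|%:R)%:E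
      @[n --> \oo] --> (1 - l)%:E.
    by apply: cvg_EFin; [exact: nearW|apply: cvgB; [exact: cvg_cst|exact: hl]].
  apply: cvg_trans hcvg; apply: near_eq_cvg.
  near=> n; rewrite (nu_zero R hO hpi) //; near: n; exact: sofic_card_gt0 hX.
have [l hl] := truncated_limit R hO hpi hG hS a j.
have [lp hlp] := truncated_limit R hO hpi hG hS a j.+1.
have [lm hlm] := truncated_limit R hO hpi hG hS a j.-1.
exists (lp + lm - 2 * l) => X hX.
under eq_fun do rewrite (nu_power R hO hpi).
apply: cvg_EFin; first exact: nearW.
pose T k n : R := (\sum_(x <- smith_exponents pi (rmul_mx (X n) a)) (k - x))%:R
  / #|X n|%:R.
have hT : T j.+1 n + T j.-1 n - 2 * T j n @[n --> \oo] --> lp + lm - 2 * l.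
  apply: cvgB; first by apply: cvgD; [exact: hlp|exact: hlm].
  by apply: cvgM; [exact: cvg_cst|exact: hl].
apply: cvg_trans hT; apply: near_eq_cvg; apply: nearW => n.
have /(congr1 (fun x => x%:R : R)) := count_second_difference
  (smith_exponents pi (rmul_mx (X n) a)) j.
rewrite natrD natrM natrD => E.
by rewrite /T mulrA -mulrDl -mulrBl -E addrK.
Unshelve. all: end_near.
Qed.
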